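(* Let $0 \leq p \leq q$ be integers, and let $i \in \{1,2,3,4,5\}$ be the integer with $i \equiv p+q \pmod 5$. Then $$\eta[CS_4(\mathcal{P}_4 : p, 1, q, 1)] = \begin{cases} 1 & \text{if } p = q,\\[2pt] \frac{4}{5}(p+q-i) + 2\left\lfloor \frac{i}{4}\right\rfloor & \text{if } p < q < 2p - \left\lfloor \frac{|p-2|}{2}\right\rfloor,\\[2pt] 2p & \text{if } q > p \text{ and } q \geq 2p - \left\lfloor \frac{|p-2|}{2}\right\rfloor. \end{cases}$$
   Context: $\mathcal{P}_4$ is the family of planar graphs of girth at least $4$ (a pair of parallel edges counts as a cycle of length 2). The Circular sprout game $CS_n(\mathcal{P}_4:t_1,\dots,t_n)$ is the following two-player game. Initially $n$ dots $v_1,\dots,v_n$ are arranged in clockwise order on a circle, $v_i$ having $t_i \ge 0$ open tips (short free partial edges) coming out into the interior of the circle. The players move alternately. A valid move consists of joining two distinct open tips by a curve lying entirely in the interior of the circle and crossing neither itself nor any previously drawn curve, and then drawing a crossbar on this curve: the intersection of the crossbar with the curve is a new vertex, which has two new open tips, one on each side of the curve. The two joined tips are no longer open. The associated graph has as vertices the dots and the curve/crossbar intersections, and as edges the curve pieces joining two such vertices together with the arcs of the circle between consecutive dots; it must belong to $\mathcal{P}_4$ at all times. The first player unable to make a valid move loses. For a finite impartial game $X$, $\eta[X]$ denotes its nimber: positions with no move have nimber $0$, and every other position has nimber equal to the least non-negative integer that is not the nimber of a position reachable in one move. *)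

(* Defs.v *)
From mathcomp Require Import all_boot all_order all_algebra.

Set Implicit Arguments.
Unset Strict Implicit.
Unset Printing Implicit Defensive.

(** * Nimbers *)

(* [has_nimber mv X k]: the impartial game played from [X] with move relation
   [mv] is finite and eta[X] = k.  The function [f] gives the nimbers of the
   positions reachable in one move, and [k] is the least natural number that
   is not one of them (0 if there is no move). *)
Inductive has_nimber (T : Type) (mv : T -> T -> Prop) (X : T) (k : nat) :
    Prop :=
  HasNimber (f : T -> nat) of
      (forall Y, mv X Y -> has_nimber mv Y (f Y)) &
      (forall Y, mv X Y -> f Y <> k) &
      (forall j, j < k -> exists2 Y, mv X Y & f Y = j).

Lemma has_nimber_uniq (T : Type) (mv : T -> T -> Prop) (X : T) (k l : nat) :
  has_nimber mv X k -> has_nimber mv X l -> k = l.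
Proof.
move=> Xk; elim: Xk l => {X k} X k f _ IH fk fj l [g gY gl gj].
have fgE Y : mv X Y -> f Y = g Y by move=> XY; exact: IH XY _ (gY Y XY).
case: (ltngtP k l) => // [/gj | /fj] [Y XY].
- by rewrite -(fgE _ XY) => /(fk _ XY).
- by rewrite (fgE _ XY) => /(gl _ XY).
Qed.

(** * Multigraphs and girth *)

(* Vertices are the natural numbers below [nverts]; the edges are the entries
   of [edges], so loops and parallel edges are possible. *)
Record multigraph := Multigraph { nverts : nat; edges : seq (nat * nat) }.

Definition joins (e : nat * nat) (u v : nat) : bool :=
  (e == (u, v)) || (e == (v, u)).

(* [es] lists positions in [edges G], which tells parallel edges apart: a loop
   is a cycle of length 1, a pair of parallel edges one of length 2. *)
Definition is_cycle (G : multigraph) (vs es : seq nat) : Prop :=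
  [/\ 0 < size vs, size es = size vs, uniq vs, uniq es &
    forall k, k < size vs ->
      nth 0 es k < size (edges G) /\
      joins (nth (0, 0) (edges G) (nth 0 es k))
            (nth 0 vs k) (nth 0 vs (k.+1 %% size vs))].

Definition girth_ge (g : nat) (G : multigraph) : Prop :=
  forall vs es, is_cycle G vs es -> g <= size vs.

(* The graphs of the game come with a crossing-free drawing (see [position]),
   hence are planar; membership in the family of planar graphs of girth at
   least 4 is thus a condition on the girth only. *)
Definition P4 : multigraph -> Prop := girth_ge 4.

(** * The Circular sprout game *)

(* The graph always contains the circle and is connected, so the curves drawn
   so far cut the interior of the circle into open discs.  A position records
   the associated graph and, for each of these discs, the open tips that point
   into it, in clockwise order along its boundary from an arbitrary starting
   point; a tip is represented by the vertex it comes out of.  Up to isotopy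
   this determines the drawing as far as future moves are concerned, because
   two boundary points of a disc are joined by a unique curve inside it. *)
Record position :=
  Position { graph : multigraph; regions : seq (seq nat) }.

(* The new vertex [nverts G] subdivides the curve joining the tips at [x] and
   [y].  The curve cuts the disc in two: one side keeps the tips [B] met going
   clockwise from [x] to [y], the other the tips [C ++ A] met from [y] to [x],
   and each side receives one of the two tips of the crossbar. *)
Inductive move (F : multigraph -> Prop) : position -> position -> Prop :=
  Move (G : multigraph) (R1 R2 : seq (seq nat)) (A B C : seq nat)
       (x y : nat) :
    let w := nverts G in
    let G' := Multigraph w.+1 ((x, w) :: (w, y) :: edges G) in
    F G' ->
    move F (Position G (R1 ++ (A ++ x :: B ++ y :: C) :: R2))
           (Position G' (R1 ++ (w :: B) :: (w :: C ++ A) :: R2)).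

Definition circle (n : nat) : multigraph :=
  Multigraph n [seq (i, i.+1 %% n) | i <- iota 0 n].

(* Initial position of CS_n( . : t_1, ..., t_n), where n = size t; the dot v_i
   is the vertex i - 1. *)
Definition CS (t : seq nat) : position :=
  Position (circle (size t))
           [:: flatten [seq nseq (nth 0 t i) i | i <- iota 0 (size t)]].

(* Main.v *)
Require Import Defs.
From mathcomp Require Import all_boot all_order all_algebra.
From mathcomp Require Import zify.
From Stdlib Require Import PeanoNat ClassicalEpsilon.

Set Implicit Arguments.
Unset Strict Implicit.
Unset Printing Implicit Defensive.

(* Starting from the 4-cycle, the graph stays bipartite without parallel edges
   and every region stays a quadrilateral: girth at least 4 forces each move to
   join opposite vertices of a region, and conversely every such move keeps the
   graph bipartite and simple.  A position is thus a sum of games on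
   quadrilaterals, and CS(p,1,q,1) has only two kinds of options:
   CS(a,1,c,1) + CS(b,1,d,1) with a+b = p-1 and c+d = q-1, and, joining the two
   single tips, a position of nimber [p > 0] xor [q > 0].
   For p <> q the nimber is 2h(p,q), where h(p,q) = min(p, q, floor(2(p+q-1)/5))
   except that h(1,q) = 1 for all q > 1.  Since nim-sums are at most sums and
   h(a,c) + h(b,d) < h(p,q) when a <> c and b <> d (except for a = b = 1 and
   c = d = 2, where the nim-sum is 0), 2h(p,q) is not the value of an option;
   options with exactly one of a = c, b = d have odd values.  Smaller odd values
   come from options with a = c, smaller even ones mostly from those with b = 0,
   by a discrete intermediate value argument: h grows by at most 1 at each step
   along a row or diagonal. *)

(** * Nim-sums *)

Notation nimsum := Nat.lxor.

Lemma half_div2 n : n./2 = Nat.div2 n.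
Proof.
have [] : n./2 = Nat.div2 n /\ n.+1./2 = Nat.div2 n.+1
  by elim: n => // n [half_n half_n1]; split; rewrite //= half_n.
by [].
Qed.

Lemma odd_testbit n : odd n = Nat.testbit n 0.
Proof.
rewrite Nat.bit0_odd; elim: n => // n IHn.
by rewrite Nat.odd_succ -Nat.negb_odd -IHn.
Qed.

Lemma odd_nimsum a b : odd (nimsum a b) = odd a (+) odd b.
Proof. by rewrite !odd_testbit Nat.lxor_spec; do 2 case: Nat.testbit. Qed.

Lemma half_nimsum a b : (nimsum a b)./2 = nimsum a./2 b./2.
Proof. by rewrite !half_div2 !Nat.div2_spec Nat.shiftr_lxor. Qed.

(** Binary induction principle for nim-sums: identities are checked on the last bit and on the
    remaining bits. *)
Lemma half_odd_inj a b : a./2 = b./2 -> odd a = odd b -> a = b.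
Proof.
by move=> eq_h eq_o; rewrite -(odd_double_half a) eq_h eq_o odd_double_half.
Qed.

Lemma nimsum_double a b : nimsum a.*2 b.*2 = (nimsum a b).*2.
Proof.
apply: half_odd_inj; first by rewrite half_nimsum !doubleK.
by rewrite odd_nimsum !odd_double.
Qed.

Lemma nimsum1_double a : nimsum 1 a.*2 = a.*2.+1.
Proof.
apply: half_odd_inj; last by rewrite odd_nimsum /= odd_double.
by rewrite half_nimsum doubleK Nat.lxor_0_l -[RHS]/(uphalf _) uphalf_double.
Qed.

Lemma nimsum_cancel a b c d :
  nimsum a (nimsum b d) = nimsum a (nimsum c d) -> b = c.
Proof.
move=> /(congr1 (fun m => nimsum (nimsum a m) d)).
rewrite -!Nat.lxor_assoc !Nat.lxor_nilpotent !Nat.lxor_0_l.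
by rewrite !Nat.lxor_assoc !Nat.lxor_nilpotent !Nat.lxor_0_r.
Qed.

Lemma leq_nimsum a b : nimsum a b <= a + b.
Proof.
have [n] := ubnP (a + b); elim: n a b => // n IHn a b lt_ab.
have [/eqP|ab_gt0] := posnP (a + b).
  by rewrite addn_eq0 => /andP[/eqP-> /eqP->].
have := IHn a./2 b./2 _; rewrite -half_nimsum.
have := odd_nimsum a b.
case: (odd a) (odd_double_half a); case: (odd b) (odd_double_half b); lia.
Qed.

(** The mex property of nim-addition. If the halves already satisfy a strict inequality, recurse on
    them and adjust the last bit; otherwise [j] is the nim-sum minus 1, exactly one summand is odd,
    and that one is decremented. *)
Lemma nimsum_lt a b j : j < nimsum a b ->
  (exists2 a', a' < a & nimsum a' b = j) \/
  (exists2 b', b' < b & nimsum a b' = j).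
Proof.
have [n] := ubnP (a + b); elim: n a b j => // n IHn a b j lt_ab lt_j.
have ab_gt0 : 0 < a + b by apply: leq_trans (leq_nimsum a b); lia.
have bit (e : bool) m : (e + m.*2)./2 = m by rewrite half_bit_double.
have obit (e : bool) m : odd (e + m.*2) = e by rewrite oddD odd_double addbF; case: e.
have [lt_h|] := ltnP j./2 (nimsum a./2 b./2).
  have [||[c lt_c eq_c]|[c lt_c eq_c]] := IHn a./2 b./2 j./2 => //; first lia.
  - left; exists ((odd j (+) odd b) + c.*2); first by case: (_ (+) _); lia.
    by apply: half_odd_inj; rewrite ?half_nimsum ?odd_nimsum ?bit ?obit // addbK.
  - right; exists ((odd j (+) odd a) + c.*2); first by case: (_ (+) _); lia.
    by apply: half_odd_inj; rewrite ?half_nimsum ?odd_nimsum ?bit ?obit // addbC addbK.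
rewrite -half_nimsum => le_h; have eq_h : (nimsum a b)./2 = j./2 by lia.
have odd_j : odd j = false by lia.
have := odd_nimsum a b; have -> : odd (nimsum a b) by lia.
case odd_a: (odd a) => /= odd_b; [left; exists a.-1 | right; exists b.-1]; try lia.
  have [ha oa] : a.-1./2 = a./2 /\ odd a.-1 = false by lia.
  apply: half_odd_inj; rewrite ?half_nimsum ?odd_nimsum ?ha ?oa -?half_nimsum //.
  by rewrite odd_j; case: (odd b) odd_b.
have [hb ob] : b.-1./2 = b./2 /\ odd b.-1 = false by lia.
apply: half_odd_inj; rewrite ?half_nimsum ?odd_nimsum ?hb ?ob -?half_nimsum //.
by rewrite odd_j odd_a.
Qed.

(** * The nimber formula *)

(* The test [m <= 1] only matters at {p, q} = {1, 2}, where the second formula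
   would give 0 instead of 1; on the diagonal [half_val] is a junk value. *)
Definition half_val (p q : nat) : nat :=
  let m := minn p q in
  if m <= 1 then m else minn m ((2 * (p + q - 1)) %/ 5).

Definition val (p q : nat) : nat := if p == q then 1 else (half_val p q).*2.

Lemma half_valC p q : half_val p q = half_val q p.
Proof. by rewrite /half_val minnC (addnC p). Qed.

Lemma valC p q : val p q = val q p.
Proof. by rewrite /val half_valC eq_sym. Qed.

Lemma discrete_ivt (f : nat -> nat) n j :
  f 0 = 0 -> (forall k, k < n -> f k.+1 <= (f k).+1) -> j <= f n ->
  exists2 k, k <= n & f k = j.
Proof.
move=> f0; elim: n => [|n IHn] f_step le_j; first by exists 0 => //; lia.
have [le_jn|lt_nj] := leqP j (f n).
  have [k lt_kn|//|k le_kn fk] := IHn; first exact/f_step/ltnW.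
  by exists k => //; exact: leqW.
by exists n.+1 => //; have := f_step n (ltnSn n); lia.
Qed.

(** Supplies the odd values: pairing [(k, q - p + k)] with a diagonal pair, of value 1, gives
    [j.*2.+1]. From [(p, q)] to [(p - 1, q - 1)] the half-value drops by at most 1, so [j] is still
    reached. *)
Lemma val_diag_option p q j : p < q -> j < half_val p q ->
  exists2 k, k < p & half_val k (q - p + k) = j.
Proof.
move=> lt_pq lt_j.
have p_gt0 : 0 < p by move: lt_j; rewrite /half_val; case: ifP; lia.
have [|k _||k le_k <-] := @discrete_ivt (fun k => half_val k (q - p + k)) p.-1 j.
- by rewrite /half_val min0n.
- by rewrite /half_val; case: ifP; case: ifP; lia.
- by move: lt_j; rewrite /half_val; case: ifP; case: ifP; lia.
by exists k => //; lia.
Qed.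

Lemma val_row_option a b j : a != b -> j <= half_val a b ->
  exists2 k, k <= b & a != k /\ half_val a k = j.
Proof.
move=> neq_ab le_j.
(* [s] skips the diagonal entry [k = a], where [half_val] is junk. The jump over it raises the
   argument of the floor by 4/5 only, so steps of at most 1 persist. *)
pose s k := if k < a then k else k.+1.
have s_b : s (if b < a then b else b.-1) = b.
  by rewrite /s; have [->//|le_ab] := ltnP b a; case: ifP; lia.
pose n := if b < a then b else b.-1.
have [|k _||k le_k <-] := @discrete_ivt (half_val a \o s) n j.
- by rewrite /s /= /half_val; case: ifP; case: ifP; lia.
- by rewrite /s /= /half_val; case: ifP; case: ifP; case: ifP; case: ifP; lia.
- by rewrite /= /n s_b.
by exists (s k) => //=; move: le_k; rewrite /n /s; case: ifP; case: ifP; lia.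
Qed.

Lemma half_val_gt1 p q : p <= q -> 1 < p ->
  half_val p q = minn p ((2 * (p + q - 1)) %/ 5).
Proof. by rewrite /half_val ltnNge => /minn_idPl -> /negbTE ->. Qed.

(** What the options with [b = 0], and then [(p - 2, p)] with [(1, 0)], leave over when [q = p + 1]:
    only [5 | p] and [j = 4p/5 - 1], which is odd, so it is an even half-value nim-added to 1. *)
Lemma half_val_consecutive p j :
  0 < j -> half_val p.-1 (p - 2) < j < half_val p p.+1 ->
  half_val (p - 2) p != j ->
  half_val (p - 3) (p - 1) = (j.-1./2).*2 /\ j = (j.-1./2).*2.+1.
Proof.
case: p => [|[|[|[|[|p]]]]] //=; [by rewrite /half_val /=; lia..|].
by rewrite !subSS !subn0 (@half_valC p.+4) !half_val_gt1 //; lia.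
Qed.

(** The floors differ by 6/5 before rounding, so a value is missed only if [5 | p + q - 1]; then
    [j = 2(p + q - 1)/5 - 1] is odd. *)
Lemma half_val_nonconsecutive p q j :
  0 < j -> p.+1 < q -> half_val p.-1 (q - 2) < j < half_val p q ->
  half_val (p - 2) (q - 3) = (j.-1./2).*2 /\ j = (j.-1./2).*2.+1.
Proof.
case: p => [|[|[|[|p]]]]; [by rewrite /half_val /=; repeat case: ifP; lia..|].
by move=> j_gt0 lt_q; rewrite !half_val_gt1; lia.
Qed.

Lemma half_val_options p q j : p < q -> 0 < j < half_val p q ->
  exists a b c d, [/\ a + b + 1 = p, c + d + 1 = q, a != c, b != d &
     nimsum (half_val a c) (half_val b d) = j].
Proof.
move=> lt_pq /andP[j_gt0 lt_j].
have p_gt1 : 1 < p by move: lt_j; rewrite /half_val; case: ifP; lia.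
(* Options with [b = 0]; the bound [m < q.-1] keeps [d] positive, hence off the diagonal. The best
   [m] is [q - 2], unless it equals [p - 1], when [p - 2] replaces it. *)
have row m : m != p.-1 -> m < q.-1 -> j <= half_val p.-1 m ->
    exists a b c d, [/\ a + b + 1 = p, c + d + 1 = q, a != c, b != d &
       nimsum (half_val a c) (half_val b d) = j].
  rewrite eq_sym => neq_m lt_m /(val_row_option neq_m)[k le_km [neq_k <-]].
  exists p.-1, 0, k, (q - 1 - k); split; try lia.
  by rewrite [half_val 0 _]/half_val min0n Nat.lxor_0_r.
have [eq_q|lt_q] : q = p.+1 \/ p.+1 < q by lia.
  have [/row|lt_mj] := leqP j (half_val p.-1 (p - 2)); first by apply; lia.
  have [eq_j|neq_j] := eqVneq (half_val (p - 2) p) j.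
    exists (p - 2), 1, p, 0; split; try lia.
    by rewrite [half_val 1 0]/half_val Nat.lxor_0_r.
  have [] := @half_val_consecutive p j; rewrite -?eq_q ?lt_mj // => even_j eq_j.
  have p_gt2 : 2 < p by move: lt_j; rewrite eq_q half_val_gt1; lia.
  exists 2, (p - 3), 1, (p - 1); split; try lia.
  by rewrite [half_val 2 1]/half_val even_j nimsum1_double -eq_j.
have [/row|lt_mj] := leqP j (half_val p.-1 (q - 2)); first by apply; lia.
have [] := @half_val_nonconsecutive p q j; rewrite ?lt_mj // => even_j eq_j.
exists 1, (p - 2), 2, (q - 3); split; try lia.
by rewrite [half_val 1 2]/half_val even_j nimsum1_double -eq_j.
Qed.

Lemma val_option p q a b c d : a + b + 1 = p -> c + d + 1 = q ->
  nimsum (val a c) (val b d) <> val p q.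
Proof.
wlog le_pq : p q a b c d / p <= q => [hwlog|].
  have [|lt_qp] := leqP p q; first exact: hwlog.
  by move=> eq_p eq_q; rewrite (valC p) (valC a) (valC b); apply: hwlog; auto.
move=> eq_p eq_q; rewrite /val.
have [eq_ac|neq_ac] := eqVneq a c; have [eq_bd|neq_bd] := eqVneq b d.
- by rewrite ifT //; lia.
- by rewrite ifN ?nimsum1_double; lia.
- by rewrite Nat.lxor_comm ifN ?nimsum1_double; lia.
rewrite nimsum_double; have [_|neq_pq] := eqVneq p q; first lia.
move/double_inj => eq_h.
(* If [half_val p q = p], the minima sum to at most [a + b = p - 1]. Otherwise the two fractions sum
   to 6/5 less than 2(p+q-1)/5; a pair {1, 2} exceeds its own fraction 4/5 by 1/5, so only two such
   pairs can spoil the strict inequality. *)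
have [[h1 h2]|lt_h] : half_val a c = 1 /\ half_val b d = 1 \/
    half_val a c + half_val b d < half_val p q.
- by clear eq_h; rewrite /half_val; repeat case: ifP; lia.
- by move: eq_h; rewrite h1 h2 Nat.lxor_nilpotent /half_val; case: ifP; lia.
by have := leq_nimsum (half_val a c) (half_val b d); lia.
Qed.

Lemma val_center p q : nimsum (0 < p) (0 < q) <> val p q.
Proof.
rewrite /val; case: eqP => [->|neq_pq]; first by rewrite Nat.lxor_nilpotent.
case: p q neq_pq => [|p] [|q] //= _.
by rewrite Nat.lxor_nilpotent /half_val; case: ifP; lia.
Qed.

Lemma val_options p q j : j < val p q ->
  nimsum (0 < p) (0 < q) = j \/
  exists a b c d, [/\ a + b + 1 = p, c + d + 1 = q &
    nimsum (val a c) (val b d) = j].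
Proof.
wlog le_pq : p q / p <= q => [hwlog|].
  have [|lt_qp] := leqP p q; first exact: hwlog.
  rewrite (valC p) => /(hwlog _ _ (ltnW lt_qp)) [<-|[a [b [c [d [? ? <-]]]]]].
    by left; rewrite Nat.lxor_comm.
  by right; exists c, d, a, b; split=> //; rewrite (valC a) (valC b).
rewrite {1}/val; case: eqP => [->|neq_pq].
  by case: j => // _; left; rewrite Nat.lxor_nilpotent.
have lt_pq : p < q by lia.
have [[i eq_j]|] : (exists i, j = i.*2.+1) \/ (exists i, j = i.*2).
- by case odd_j: (odd j); [left | right]; exists j./2; lia.
- move=> lt_j; have [||k lt_k eq_i] := @val_diag_option p q i => //; first lia.
  right; exists (p.-1 - k), k, (p.-1 - k), (q - p + k); split; try lia.
  by rewrite /val eqxx ifN ?eq_i ?nimsum1_double; lia.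
case=> [[|i]] -> lt_j.
  (* The value 0 comes from joining the two single tips, as [p] and [q] are both positive here. *)
  left; have: 0 < half_val p q by lia.
  by case: p q lt_pq {le_pq neq_pq lt_j} => [|p] [|q].
have [||a [b [c [d [? ? ? ? eq_i]]]]] := @half_val_options p q i.+1 => //; first lia.
right; exists a, b, c, d; split=> //.
by rewrite /val !ifN // nimsum_double eq_i.
Qed.

(** * Graphs and regions *)

(** Lets the nimbers of the options be given one at a time: [epsilon] collects them into the
    required function, and uniqueness of nimbers makes its choices right. *)
Lemma has_nimber_intro (T : Type) (mv : T -> T -> Prop) (X : T) (k : nat) :
  (forall Y, mv X Y -> exists2 m, has_nimber mv Y m & m <> k) ->
  (forall j, j < k -> exists2 Y, mv X Y & has_nimber mv Y j) ->
  has_nimber mv X k.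
Proof.
move=> options reach; pose f Y := epsilon (inhabits 0) (has_nimber mv Y).
have fP Y m : has_nimber mv Y m -> f Y = m.
  by move=> Ym; apply: (has_nimber_uniq _ Ym); apply: epsilon_spec; exists m.
exists f => [Y /options[m Ym _] | Y /options[m Ym neq_mk] | j /reach[Y XY Yj]].
- by rewrite (fP _ _ Ym).
- by rewrite (fP _ _ Ym).
- by exists Y => //; exact: fP.
Qed.

Definition extend (G : multigraph) (x y : nat) : multigraph :=
  Multigraph (nverts G).+1 ((x, nverts G) :: (nverts G, y) :: edges G).

Lemma move_inv F G Rs Y : move F (Position G Rs) Y ->
  exists R1 R2 A B C x y,
    [/\ Rs = R1 ++ (A ++ x :: B ++ y :: C) :: R2, F (extend G x y) &
      Y = Position (extend G x y)
            (R1 ++ (nverts G :: B) :: (nverts G :: C ++ A) :: R2)].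
Proof.
move=> mvY; inversion mvY as [G0 R1 R2 A B C x y w G' FG' eqG eqY].
by exists R1, R2, A, B, C, x, y.
Qed.

(** * Girth at least 4 through simple bipartite graphs *)

Definition adj (G : multigraph) (u v : nat) : bool :=
  has (fun e => joins e u v) (edges G).

Lemma joinsC e u v : joins e u v = joins e v u.
Proof. exact: orbC. Qed.

Lemma adjC G u v : adj G u v = adj G v u.
Proof. by apply: eq_has => e; exact: joinsC. Qed.

Definition bipartite (col : nat -> bool) (G : multigraph) : bool :=
  all (fun e => [&& e.1 < nverts G, e.2 < nverts G & col e.1 != col e.2])
    (edges G).

Definition no_parallel (G : multigraph) : bool :=
  pairwise (fun e f => ~~ joins e f.1 f.2) (edges G).

Lemma bipartite_joins col G e u v : bipartite col G ->
  e \in edges G -> joins e u v ->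
  [/\ u < nverts G, v < nverts G & col u != col v].
Proof.
move=> /allP bip /bip/and3P[]; case: e => a b /= lt_a lt_b neq_ab.
by case/orP=> /eqP[<- <-]; split=> //; rewrite eq_sym.
Qed.

Lemma bipartite_adj col G u v : bipartite col G -> adj G u v ->
  [/\ u < nverts G, v < nverts G & col u != col v].
Proof. by move=> bip /hasP[e]; exact: bipartite_joins. Qed.

Lemma no_parallel_nth G k l u v : no_parallel G ->
  k < size (edges G) -> l < size (edges G) ->
  joins (nth (0, 0) (edges G) k) u v -> joins (nth (0, 0) (edges G) l) u v ->
  k = l.
Proof.
move=> /(pairwiseP (0, 0)) nopar lt_k lt_l.
wlog lt_kl : k l lt_k lt_l / k < l => [hwlog jk jl|].
  case: (ltngtP k l) => // [/hwlog|/hwlog h]; first exact.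
  by apply/esym/h.
have := nopar k l lt_k lt_l lt_kl.
case: (nth _ _ k) => a b; case: (nth _ _ l) => c d; rewrite /joins /=.
move=> /negP h /orP[]/eqP[? ?] /orP[]/eqP[? ?];
  by case: h; subst; rewrite !eqxx ?orbT.
Qed.

(** Cycles of length 1 and 3 are odd, hence break the colouring; a cycle of length 2 is a pair of
    parallel edges. *)
Lemma bipartite_girth col G : bipartite col G -> no_parallel G -> P4 G.
Proof.
move=> bip nopar vs es [+ + + uniq_es cyc].
have colP k : k < size vs ->
    col (nth 0 vs k) != col (nth 0 vs (k.+1 %% size vs)).
  by move=> /cyc[lt_k jk]; have [] := bipartite_joins bip (mem_nth _ lt_k) jk.
case: vs cyc colP => [|u [|v [|w [|? ?]]]] //= cyc colP _ eq_sz.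
- by have := colP 0 isT; rewrite eqxx.
- case: es eq_sz uniq_es cyc => [|e [|f []]] //= _; rewrite inE andbT => neq_ef cyc _.
  have [lt_e je] := cyc 0 isT; have [lt_f jf] := cyc 1 isT.
  by case/eqP: neq_ef; apply: no_parallel_nth lt_e lt_f je _; rewrite //= joinsC.
- have := colP 0 isT; have := colP 1 isT; have := colP 2 isT => /=.
  by case: (col u) (col v) (col w) => [] [] [].
Qed.

(** Equal ends would create two parallel edges at the new vertex, adjacent ends a triangle through
    it. *)
Lemma P4_extend G x y : P4 (extend G x y) ->
  x < nverts G -> y < nverts G -> x != y /\ ~~ adj G x y.
Proof.
move=> girth lt_x lt_y.
have neq_x : nverts G != x by rewrite gtn_eqF.
have neq_y : nverts G != y by rewrite gtn_eqF.
have neq_xy : x != y.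
  apply/negP=> /eqP eq_xy.
  suff /girth: is_cycle (extend G x y) [:: nverts G; x] [:: 0; 1] by [].
  split=> //=; first by rewrite inE neq_x.
  by case=> [|[|]] //= _; rewrite /joins -?eq_xy eqxx ?orbT.
split=> //; apply/negP => /(has_nthP (0, 0))[k lt_k jk].
(* The two new edges have positions 0 and 1, which shifts the old ones by 2. *)
suff /girth: is_cycle (extend G x y) [:: x; nverts G; y] [:: 0; 1; k.+2] by [].
split=> //=; first by rewrite !inE neq_y eq_sym negb_or neq_x neq_xy.
by case=> [|[|[|]]] //= _; rewrite /joins ?eqxx ?orbT // -/(joins _ _ _) joinsC.
Qed.

Lemma adj_extend G x y u v : adj G u v -> adj (extend G x y) u v.
Proof. by rewrite /adj /= => ->; rewrite !orbT. Qed.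

Lemma adj_extendl G x y : adj (extend G x y) (nverts G) x.
Proof. by rewrite /adj /= /joins eqxx orbT. Qed.

Lemma adj_extendr G x y : adj (extend G x y) (nverts G) y.
Proof. by rewrite /adj /= /joins eqxx !orbT. Qed.

Lemma bipartite_extend col G x y : bipartite col G ->
  x < nverts G -> y < nverts G -> col x = col y ->
  exists col', bipartite col' (extend G x y).
Proof.
move=> bip lt_x lt_y eq_col.
exists (fun u => if u == nverts G then ~~ col x else col u).
rewrite /bipartite /= eqxx !ltnS leqnn !(ltnW lt_x) !(ltnW lt_y) !ltn_eqF //=.
rewrite eq_col; case: (col y) => /=;
  apply/allP=> e /(allP bip)/and3P[lt1 lt2 neq_e];
  by rewrite !ltnS (ltnW lt1) (ltnW lt2) !ltn_eqF.
Qed.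

Lemma no_parallel_extend col G x y : bipartite col G -> no_parallel G ->
  x < nverts G -> y < nverts G -> x != y -> no_parallel (extend G x y).
Proof.
move=> bip nopar lt_x lt_y neq_xy.
rewrite /no_parallel /= -[pairwise _ _]/(no_parallel G) nopar andbT.
have new e z : e \in edges G ->
    ~~ joins (z, nverts G) e.1 e.2 /\ ~~ joins (nverts G, z) e.1 e.2.
  case: e => a b /(allP bip)/and3P[/= lt_a lt_b _].
  by rewrite /joins !xpair_eqE ![nverts G == _]gtn_eqF // !andbF.
apply/andP; split; last by apply/allP=> e /(new _ y)[].
rewrite /joins !xpair_eqE /= (ltn_eqF lt_x) eqxx andbT neq_xy /=.
by apply/allP=> e /(new _ x)[].
Qed.

(** * The abstract game on quadrilaterals *)

Definition quad := (nat * nat * nat * nat)%type.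

(* New regions start at the new vertex, so the tips of a region are always
   listed vertex by vertex along the quadrilateral, without rotation. *)
Inductive face (G : multigraph) : quad -> seq nat -> Prop :=
  Face a b c d x1 x2 x3 x4 of
    adj G x1 x2 & adj G x2 x3 & adj G x3 x4 & adj G x4 x1 &
    x1 != x3 & x2 != x4 :
  face G (a, b, c, d) (nseq a x1 ++ nseq b x2 ++ nseq c x3 ++ nseq d x4).

(** A [quad] counts the tips at the four corners in clockwise order. The new vertex is the first
    corner of both halves, with one crossbar tip in each; the other tips at a joined corner are
    shared between the halves. *)
Inductive quad_move : quad -> quad -> quad -> Prop :=
| QuadMove13 a1 a2 b c1 c2 d :
    quad_move ((a1 + a2).+1, b, (c1 + c2).+1, d) (1, a2, b, c1) (1, c2, d, a1)
| QuadMove24 a b1 b2 c d1 d2 :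
    quad_move (a, (b1 + b2).+1, c, (d1 + d2).+1) (1, b2, c, d1) (1, d2, a, b1).

(** A family closed under moves. Joining the tips at the [p] and [q] corners gives two games of the
    second form; joining the single tips gives two of the third, each over after at most one move.
    The last two have no move. *)
Inductive quad_val : quad -> nat -> Prop :=
| QuadVal1 p q : quad_val (p, 1, q, 1) (val p q)
| QuadVal2 p q : quad_val (1, p, 1, q) (val p q)
| QuadVal3 q : quad_val (1, 0, q, 0) (0 < q)
| QuadVal4 q : quad_val (1, 0, 0, q) 0
| QuadVal5 q : quad_val (1, q, 0, 0) 0.

Lemma quad_val_option t v l r : quad_val t v -> quad_move t l r ->
  exists vl vr, [/\ quad_val l vl, quad_val r vr & nimsum vl vr <> v].
Proof.
move=> qv mv; case: mv qv => [a1 a2 b c1 c2 d|a b1 b2 c d1 d2] qv;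
  inversion qv; subst.
- exists (val a2 c1), (val c2 a1); split; [by constructor..|].
  by rewrite (valC c2); apply: val_option; lia.
- have [? ? ? ?] : [/\ a1 = 0, a2 = 0, c1 = 0 & c2 = 0] by split; lia.
  subst; exists (0 < b), (0 < d); split; [by constructor..|exact: val_center].
- have [? ?] : a1 = 0 /\ a2 = 0 by lia.
  by subst; exists 0, 0; split; [exact: QuadVal4 | exact: QuadVal5 |].
- have [? ? ? ?] : [/\ b1 = 0, b2 = 0, d1 = 0 & d2 = 0] by split; lia.
  subst; exists (0 < c), (0 < a); split; [by constructor..|].
  by rewrite Nat.lxor_comm; exact: val_center.
- exists (val b2 d1), (val d2 b1); split; [by constructor..|].
  by rewrite (valC d2); apply: val_option; lia.
Qed.

Lemma quad_val_reach t v j : quad_val t v -> j < v ->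
  exists l r vl vr,
    [/\ quad_move t l r, quad_val l vl, quad_val r vr & nimsum vl vr = j].
Proof.
case=> [p q|p q|q|q|q] //.
- move=> /val_options[eq_j|[a [b [c [d [<- <- <-]]]]]].
    exists (1, 0, q, 0), (1, 0, p, 0), (0 < q), (0 < p).
    split; [exact: (QuadMove24 p 0 0 q 0 0) | by constructor.. |].
    by rewrite Nat.lxor_comm.
  exists (1, a, 1, c), (1, d, 1, b), (val a c), (val b d).
  split=> //; [|by constructor|by rewrite valC; constructor].
  by rewrite (addnC a) !addn1; constructor.
- move=> /val_options[eq_j|[a [b [c [d [<- <- <-]]]]]].
    exists (1, 0, p, 0), (1, 0, q, 0), (0 < p), (0 < q).
    split=> //; [exact: (QuadMove13 0 0 p 0 0 q) | by constructor..].
  exists (1, a, 1, c), (1, d, 1, b), (val a c), (val b d).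
  split=> //; [|by constructor|by rewrite valC; constructor].
  by rewrite (addnC a) !addn1; constructor.
- case: q j => [|q] [|j] // _.
  exists (1, 0, 0, 0), (1, q, 0, 0), 0, 0.
  split; [|exact: QuadVal4|exact: QuadVal5|by []].
  exact: (QuadMove13 0 0 0 0 q 0).
Qed.

(** All copies of [x] lie in one block, so cutting the list at a copy cuts that block. *)
Lemma nseq_split (I : eqType) (x : I) n A T S Z : x \notin S -> x \notin Z ->
  A ++ x :: T = S ++ nseq n x ++ Z ->
  exists n1 n2, [/\ n = (n1 + n2).+1, A = S ++ nseq n1 x & T = nseq n2 x ++ Z].
Proof.
elim: S A => [|s S IHS] A /= xS xZ.
  elim: n A => [|n IHn] [|y A] /=.
  - by move=> eqZ; rewrite -eqZ mem_head in xZ.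
  - by move=> eqZ; rewrite -eqZ inE mem_cat mem_head !orbT in xZ.
  - by case=> ->; exists 0, n.
  - by case=> -> /IHn[n1 [n2 [-> -> ->]]]; exists n1.+1, n2.
move: xS; rewrite inE negb_or => /andP[neq_xs xS].
case: A => [|y A] /= [eq_s]; first by rewrite eq_s eqxx in neq_xs.
by move=> /(IHS _ xS xZ)[n1 [n2 [-> -> ->]]]; exists n1, n2; rewrite eq_s.
Qed.

Lemma face_extend G x y t R : face G t R -> face (extend G x y) t R.
Proof. by case=> *; constructor => //; exact: adj_extend. Qed.

(** Serves both halves of a cut along either diagonal [u], [z]: the kept corner [v] faces the new
    vertex. *)
Lemma half_face col G x y u v z k n m : bipartite col G ->
  adj G u v -> adj G v z -> u != z ->
  adj (extend G x y) (nverts G) u -> adj (extend G x y) (nverts G) z ->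
  face (extend G x y) (1, k, n, m)
    (nverts G :: nseq k u ++ nseq n v ++ nseq m z).
Proof.
move=> bip uv vz neq_uz wu wz; have [_ lt_v _] := bipartite_adj bip uv.
apply: (@Face _ 1 k n m (nverts G) u v z) => //; try exact: adj_extend.
- by rewrite adjC.
- by rewrite gtn_eqF.
Qed.

Lemma quad_colors col G x1 x2 x3 : bipartite col G ->
  adj G x1 x2 -> adj G x2 x3 ->
  [/\ x1 < nverts G, x3 < nverts G, x1 != x2 & col x1 = col x3].
Proof.
move=> bip /(bipartite_adj bip)[lt1 lt2 neq12] /(bipartite_adj bip)[_ lt3 neq23].
split=> //; first by apply: contraNneq neq12 => ->.
by move: neq12 neq23; do 3 case: (col _).
Qed.

Lemma face_quad_move col G t l r R : bipartite col G ->
  face G t R -> quad_move t l r ->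
  exists A B C x y, let G' := extend G x y in let w := nverts G in
    [/\ R = A ++ x :: B ++ y :: C, face G' l (w :: B), face G' r (w :: C ++ A),
       [/\ x < w, y < w & x != y] & col x = col y].
Proof.
move=> bip [a b c d x1 x2 x3 x4 x12 x23 x34 x41 neq13 neq24] mv.
have [lt1 lt3 _ col13] := quad_colors bip x12 x23.
have [lt2 lt4 _ col24] := quad_colors bip x23 x34.
inversion mv as [a1 a2 ? c1 c2|? b1 b2 ? d1 d2]; subst.
- exists (nseq a1 x1), (nseq a2 x1 ++ nseq b x2 ++ nseq c1 x3),
    (nseq c2 x3 ++ nseq d x4), x1, x3.
  split=> //; [|apply: half_face bip _ _ _ _ _|
               rewrite -catA; apply: half_face bip _ _ _ _ _];
    rewrite ?adj_extendl ?adj_extendr // 1?eq_sym //.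
  by rewrite -!addnS !nseqD -!catA.
- exists (nseq a x1 ++ nseq b1 x2), (nseq b2 x2 ++ nseq c x3 ++ nseq d1 x4),
    (nseq d2 x4), x2, x4.
  split=> //; [|apply: half_face bip _ _ _ _ _|apply: half_face bip _ _ _ _ _];
    rewrite ?adj_extendl ?adj_extendr // 1?eq_sym //.
  by rewrite -!addnS !nseqD -!catA.
Qed.

(** Girth excludes equal and adjacent ends, leaving only the diagonals. *)
Lemma face_move col G t A B C x y : bipartite col G ->
  face G t (A ++ x :: B ++ y :: C) -> P4 (extend G x y) ->
  let G' := extend G x y in let w := nverts G in
  exists l r,
    [/\ quad_move t l r, face G' l (w :: B), face G' r (w :: C ++ A),
       [/\ x < w, y < w & x != y] & col x = col y].
Proof.
move=> bip fc girth /=.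
move eqR: (A ++ _) fc => R fc.
case: fc eqR => {t R} a b c d x1 x2 x3 x4 x12 x23 x34 x41 neq13 neq24 eqR.
have [lt1 lt3 neq12 col13] := quad_colors bip x12 x23.
have [lt2 lt4 neq23 col24] := quad_colors bip x23 x34.
have [_ _ neq34 _] := quad_colors bip x34 x41.
have [_ _ neq41 _] := quad_colors bip x41 x12.
have neqs := (negbTE neq12, negbTE neq13, negbTE neq23, negbTE neq24,
              negbTE neq34, negbTE neq41).
have neqs' := (neqs, eq_sym x2 x1, eq_sym x3 x1, eq_sym x3 x2, eq_sym x4 x2,
               eq_sym x4 x3, eq_sym x1 x4).
have inR z : (z \in nseq a x1 ++ nseq b x2 ++ nseq c x3 ++ nseq d x4) ->
    [|| z == x1, z == x2, z == x3 | z == x4].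
  by rewrite !mem_cat !mem_nseq; do 4 case: (z == _); rewrite ?andbF.
have xR : x \in nseq a x1 ++ nseq b x2 ++ nseq c x3 ++ nseq d x4.
  by rewrite -eqR mem_cat mem_head orbT.
have yR : y \in nseq a x1 ++ nseq b x2 ++ nseq c x3 ++ nseq d x4.
  by rewrite -eqR !(mem_cat, inE) eqxx !orbT.
have ltR z : z \in nseq a x1 ++ nseq b x2 ++ nseq c x3 ++ nseq d x4 ->
    z < nverts G.
  by case/inR/or4P=> /eqP->.
have [neq_xy nadj] := P4_extend girth (ltR x xR) (ltR y yR).
have yT : y \in B ++ y :: C by rewrite mem_cat mem_head orbT.
have split_x n S Z : x \notin S -> x \notin Z ->
    nseq a x1 ++ nseq b x2 ++ nseq c x3 ++ nseq d x4 = S ++ nseq n x ++ Z ->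
    exists n1 n2, [/\ n = (n1 + n2).+1, A = S ++ nseq n1 x &
      B ++ y :: C = nseq n2 x ++ Z].
  by move=> xS xZ eqS; apply: nseq_split; rewrite // eqR.
case/or4P: (inR x xR) => /eqP eq_x; case/or4P: (inR y yR) => /eqP eq_y;
  subst x y; rewrite ?eqxx // in neq_xy nadj;
  try (by rewrite ?x12 ?x23 ?x34 ?x41 // adjC ?x12 ?x23 ?x34 ?x41 in nadj).
- have [||//|a1 [a2 [-> -> eqT]]] :=
    split_x a [::] (nseq b x2 ++ nseq c x3 ++ nseq d x4).
  + by [].
  + by rewrite !mem_cat !mem_nseq !neqs' !andbF.
  have [||//|c1 [c2 [-> -> ->]]] :=
    @nseq_split _ x3 c B C (nseq a2 x1 ++ nseq b x2) (nseq d x4).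
  + by rewrite !mem_cat !mem_nseq !neqs' !andbF.
  + by rewrite !mem_nseq !neqs' !andbF.
  + by rewrite eqT -catA.
  exists (1, a2, b, c1), (1, c2, d, a1); split=> //; [by constructor|..];
    rewrite -catA; apply: half_face bip _ _ _ _ _;
    rewrite ?adj_extendl ?adj_extendr // 1?eq_sym //.
- have [||//|b1 [b2 [-> -> eqT]]] :=
    split_x b (nseq a x1) (nseq c x3 ++ nseq d x4).
  + by rewrite !mem_nseq !neqs' !andbF.
  + by rewrite !mem_cat !mem_nseq !neqs' !andbF.
  have [||//|d1 [d2 [-> -> ->]]] :=
    @nseq_split _ x4 d B C (nseq b2 x2 ++ nseq c x3) [::].
  + by rewrite !mem_cat !mem_nseq !neqs' !andbF.
  + by [].
  + by rewrite eqT cats0 -catA.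
  rewrite cats0; exists (1, b2, c, d1), (1, d2, a, b1).
  split=> //; [by constructor|..];
    rewrite -?catA; apply: half_face bip _ _ _ _ _;
    rewrite ?adj_extendl ?adj_extendr // 1?eq_sym //.
(* The last two cases traverse a diagonal backwards, which is impossible since [y] follows [x] in
   the list. *)
- have [||//|n1 [n2 [_ _ eqT]]] :=
    split_x c (nseq a x1 ++ nseq b x2) (nseq d x4);
    rewrite -?catA // ?mem_cat ?mem_nseq ?neqs' ?andbF //.
  by move: yT; rewrite eqT mem_cat !mem_nseq !neqs' !andbF.
- have [||//|n1 [n2 [_ _ eqT]]] :=
    split_x d (nseq a x1 ++ nseq b x2 ++ nseq c x3) [::];
    rewrite -?catA ?cats0 // ?mem_cat ?mem_nseq ?neqs' ?andbF //.
  by move: yT; rewrite eqT cats0 mem_nseq !neqs' !andbF.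
Qed.

(** * Positions as sums of quadrilateral games *)

Inductive total (G : multigraph) : seq (seq nat) -> nat -> Prop :=
| TotalNil : total G [::] 0
| TotalCons t R v Rs n of face G t R & quad_val t v & total G Rs n :
    total G (R :: Rs) (nimsum v n).

Lemma total_cat G R1 R2 v1 v2 :
  total G R1 v1 -> total G R2 v2 -> total G (R1 ++ R2) (nimsum v1 v2).
Proof.
move=> tot1 tot2; elim: tot1 => [|t R v Rs n fc qv _ IH] /=.
  by rewrite Nat.lxor_0_l.
by rewrite Nat.lxor_assoc; apply: TotalCons qv IH.
Qed.

Lemma total_inv G R1 R R2 v : total G (R1 ++ R :: R2) v ->
  exists t v1 vR v2, [/\ total G R1 v1, face G t R, quad_val t vR, total G R2 v2
    & v = nimsum v1 (nimsum vR v2)].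
Proof.
elim: R1 v => [|S R1 IH] v tot;
  inversion tot as [|t S' vS Rs' n fc qv tot']; subst.
  by exists t, 0, vS, n; split; rewrite ?Nat.lxor_0_l //; constructor.
have [t' [v1 [vR [v2 [tot1 fcR qvR tot2 ->]]]]] := IH _ tot'.
exists t', (nimsum vS v1), vR, v2; split=> //; last by rewrite Nat.lxor_assoc.
exact: TotalCons qv tot1.
Qed.

Lemma total_lt G Rs v j : total G Rs v -> j < v ->
  exists R1 R R2 t v1 vR v2 k,
    [/\ Rs = R1 ++ R :: R2,
        [/\ total G R1 v1, face G t R, quad_val t vR & total G R2 v2],
        k < vR & nimsum v1 (nimsum k v2) = j].
Proof.
move=> tot; elim: tot j => [//|t R vR Rs' n fc qv tot' IH] j.
move=> /nimsum_lt[[k lt_k <-]|[m /IH + <-]].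
  exists [::], R, Rs', t, 0, vR, n, k; split; rewrite ?Nat.lxor_0_l //.
  by split=> //; constructor.
case=> R1 [R' [R2 [t' [v1 [v' [v2 [k [-> [tot1 fc' qv' tot2] lt_k <-]]]]]]]].
exists (R :: R1), R', R2, t', (nimsum vR v1), v', v2, k.
split=> //; last by rewrite Nat.lxor_assoc.
by split=> //; exact: TotalCons qv tot1.
Qed.

Lemma total_extend G x y Rs v : total G Rs v -> total (extend G x y) Rs v.
Proof.
elim=> [|t R vR Rs' n fc qv _ IH]; first by constructor.
by apply: TotalCons qv IH; exact: face_extend.
Qed.

(** The Sprague-Grundy argument: a move changes the value of one region, hence the nim-sum;
    conversely a smaller nim-sum is reached by lowering one region. *)
Lemma total_nimber col G Rs v : bipartite col G -> no_parallel G ->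
  total G Rs v -> has_nimber (move P4) (Position G Rs) v.
Proof.
(* The number of tips is constant, but each move adds a nonempty region. *)
have [n] := ubnP (sumn [seq (size R).-1 | R <- Rs]).
elim: n col G Rs v => // n IHn col G Rs v lt_n bip nopar tot.
(* Common to both directions: joining opposite corners is legal, and the induction hypothesis
   evaluates the result. *)
have step R1 R2 A B C x y l r v1 vl vr v2 :
    Rs = R1 ++ (A ++ x :: B ++ y :: C) :: R2 ->
    let G' := extend G x y in let w := nverts G in
    face G' l (w :: B) -> face G' r (w :: C ++ A) ->
    [/\ x < w, y < w & x != y] -> col x = col y ->
    quad_val l vl -> quad_val r vr -> total G R1 v1 -> total G R2 v2 ->
    let P' := Position G' (R1 ++ (w :: B) :: (w :: C ++ A) :: R2) in
    has_nimber (move P4) P' (nimsum v1 (nimsum (nimsum vl vr) v2)) /\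
    move P4 (Position G Rs) P'.
  move=> eqRs G' w fcl fcr [lt_x lt_y neq_xy] eq_col qvl qvr tot1 tot2 P'.
  have [col' bip'] := bipartite_extend bip lt_x lt_y eq_col.
  have nopar' := no_parallel_extend bip nopar lt_x lt_y neq_xy.
  split; last by rewrite eqRs; constructor; exact: bipartite_girth bip' nopar'.
  apply: (IHn col') => //.
    move: lt_n; rewrite eqRs !map_cat !sumn_cat /= !size_cat /= !size_cat /=.
    lia.
  apply: total_cat; first exact: total_extend.
  rewrite Nat.lxor_assoc; apply: (TotalCons fcl) => //.
  by apply: (TotalCons fcr) => //; exact: total_extend.
apply: has_nimber_intro => [Y|j lt_j].
  case/move_inv=> R1 [R2 [A [B [C [x [y [eqRs girth ->]]]]]]].
  move: tot; rewrite eqRs => /total_inv[t [v1 [vR [v2 [tot1 fc qv tot2 ->]]]]].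
  have [l [r [mv fcl fcr lt_xy eq_col]]] := face_move bip fc girth.
  have [vl [vr [qvl qvr neq_v]]] := quad_val_option qv mv.
  exists (nimsum v1 (nimsum (nimsum vl vr) v2)); last by move/nimsum_cancel.
  by have [] := step _ _ _ _ _ _ _ _ _ _ _ _ _ eqRs fcl fcr lt_xy eq_col
    qvl qvr tot1 tot2.
have [R1 [R [R2 [t [v1 [vR [v2 [k [eqRs [tot1 fc qv tot2] lt_k <-]]]]]]]]] :=
  total_lt tot lt_j.
have [l [r [vl [vr [mv qvl qvr <-]]]]] := quad_val_reach qv lt_k.
have [A [B [C [x [y /= [eqR fcl fcr lt_xy eq_col]]]]]] := face_quad_move bip fc mv.
rewrite eqR in eqRs.
have [nimP mvP] := step _ _ _ _ _ _ _ _ _ _ _ _ _ eqRs fcl fcr lt_xy eq_col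
  qvl qvr tot1 tot2.
by exists (Position (extend G x y)
  (R1 ++ (nverts G :: B) :: (nverts G :: C ++ A) :: R2)).
Qed.

Lemma CS_nimber p q : has_nimber (move P4) (CS [:: p; 1; q; 1]) (val p q).
Proof.
(* Parity of the labels properly colours the initial 4-cycle. *)
apply: (@total_nimber odd) => //.
rewrite -(Nat.lxor_0_r (val p q)); apply: TotalCons (TotalNil _).
- exact: (@Face _ p 1 q 1 0 1 2 3).
- exact: QuadVal1.
Qed.

Theorem theorem5p1 (p q i : nat) :
  p <= q -> 1 <= i <= 5 -> i = p + q %[mod 5] ->
  let bound : int := (2 * p%:Z - (`|p%:Z - 2| %/ 2)%Z)%R in
  [/\ p = q ->
        has_nimber (move P4) (CS [:: p; 1; q; 1]) 1,
      p < q -> (q%:Z < bound)%R ->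
        has_nimber (move P4) (CS [:: p; 1; q; 1])
          ((4 * (p + q - i)) %/ 5 + 2 * (i %/ 4)) &
      p < q -> (bound <= q%:Z)%R ->
        has_nimber (move P4) (CS [:: p; 1; q; 1]) (2 * p)].
Proof.
move=> le_pq i15 eq_i bound; have := CS_nimber p q; rewrite /val.
have [<- nimP|neq_pq] := eqVneq p q; first by split=> //; rewrite ltnn.
split=> [eq_pq|lt_pq lt_q|lt_pq le_q]; first by rewrite eq_pq eqxx in neq_pq.
(* With [p + q = 5k + i], the floor of 2(p+q-1)/5 is [2k + i %/ 4]. *)
- suff <- : (half_val p q).*2 = (4 * (p + q - i)) %/ 5 + 2 * (i %/ 4) by [].
  rewrite /half_val; case: ifP; lia.
(* For [p >= 2] the bound is the least [q] with [2q >= 3p + 2], where the floor reaches [p]; for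
   [p <= 1] every [q > p] is beyond the bound. *)
- suff <- : (half_val p q).*2 = 2 * p by [].
  rewrite /half_val; case: ifP; lia.
Qed.
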